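(* Consider the learning iteration of trial (data) length $n$ described in the context, with $n\times n$ state transition matrix $\mathbf A=\mathbf Q_u-\alpha\,\mathbf N^T(\mathbf G^-)^T\mathbf Q_e\,\mathbf G^-\mathbf N$ and eigenvalues $\lambda_1(\mathbf A),\dots,\lambda_n(\mathbf A)$. Iteration convergence means that $\mathbf A$ is stable, i.e. $\max_{1\le m\le n}|\lambda_m(\mathbf A)|<1$. Consider the frequency domain $H_\infty$ norm condition $$\text{(H)}\qquad \left|Q_u(z,z^{-1})-\alpha\,Q_e(z,z^{-1})\,G^-(z^{-1})\,G^-(z)\right|_\infty<1,$$ where $|\cdot|_\infty$ denotes the maximum of the modulus over $z=e^{-j\theta}$, $\theta\in[0,\pi]$. (i) Condition (H) is sufficient for iteration convergence: if (H) holds, then $\max_{1\le m\le n}|\lambda_m(\mathbf A)|<1$. (ii) As the data length $n$ approaches infinity, condition (H) also becomes necessary; that is, in the limiting case $n\to\infty$, (H) becomes both necessary and sufficient for iteration convergence, $\max_{m}|\lambda_m(\mathbf A)|<1$.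
   Context: Plant: a stable causal linear time-invariant discrete-time plant of relative degree $d=1$ (taken without loss of generality), factored as $G(z^{-1})=z^{-d}G^+(z^{-1})G^-(z^{-1})$ into an invertible part $G^+$ and a non-invertible, all-zero part $G^-(z^{-1})=\sum_{i=0}^{\nu}g_iz^{-i}$ with real coefficients, where $\nu$ is the number of unstable zeros; $G^-(z)=\sum_{i=0}^{\nu}g_iz^{i}$. The initial condition is the same in every trial and is ignored. Learning filters: $\alpha$ is a real learning gain, and $Q_u$, $Q_e$ are zero-phase filters of orders $\mu_u$, $\mu_e$ with real coefficients: $Q_u(z,z^{-1})=q^u_0+\sum_{i=1}^{\mu_u}q^u_i(z^i+z^{-i})$ with $\sum_{i=0}^{\mu_u}q^u_i=1$, and $Q_e(z,z^{-1})=q^e_0+\sum_{i=1}^{\mu_e}q^e_i(z^i+z^{-i})$ with $\sum_{i=0}^{\mu_e}q^e_i=1$. Matrices for trial length $n$ (indices start at 1): - $\mathbf G^-$ is $(n+2\nu)\times(n+2\nu)$ with $\mathbf G^-_{ij}=g_{i-j}$ if $0\le i-j\le\nu$ and $0$ otherwise. - $\mathbf Q_u$ is $n\times n$ with $(\mathbf Q_u)_{ij}=q^u_{|i-j|}$ if $|i-j|\le\mu_u$ and $0$ otherwise. - $\mathbf Q_e$ is $(n+2\nu)\times(n+2\nu)$ with $(\mathbf Q_e)_{ij}=q^e_{|i-j|}$ if $|i-j|\le\mu_e$ and $0$ otherwise. - $\mathbf N$ is the $(n+2\nu)\times n$ zero-padding matrix with $\mathbf N_{ij}=1$ if $i=j+\nu$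 and $0$ otherwise. Learning iteration: for a reference $\mathbf r\in\mathbb R^{n+2\nu}$ and controls $\bar{\mathbf u}_k\in\mathbb R^n$ ($k$ is the trial index; $\mathbf N\bar{\mathbf u}_k$ is the zero-padded control, already filtered by the invertible part of the plant), the output is $\mathbf y_k=\mathbf G^-\mathbf N\bar{\mathbf u}_k$, the tracking error is $\mathbf e_k=\mathbf r-\mathbf y_k$, and the update law is $\bar{\mathbf u}_{k+1}=\mathbf Q_u\bar{\mathbf u}_k+\mathbf F\mathbf e_k$ with $\mathbf F=\alpha\mathbf N^T(\mathbf G^-)^T\mathbf Q_e$. Hence $\bar{\mathbf u}_{k+1}=\mathbf A\bar{\mathbf u}_k+\mathbf F\mathbf r$. The matrix $\mathbf A$ is a symmetric banded Toeplitz matrix. *)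

(* Defs.v *)
From HB Require Import structures.
From mathcomp Require Import all_boot all_order all_algebra.
From mathcomp Require Import all_classical all_reals all_analysis.
From mathcomp Require Import complex.
Set Implicit Arguments.
Unset Strict Implicit.
Unset Printing Implicit Defensive.
Import Order.TTheory GRing.Theory Num.Theory.
Import numFieldNormedType.Exports.
Local Open Scope classical_set_scope.
Local Open Scope complex_scope.
Local Open Scope ring_scope.

(* The R-valued modulus; the norm `|x| of R[i] takes its values in R[i]. *)
Definition modulus (R : realType) (x : R[i]) : R := complex.Re `|x|.

(* G^-(w) = \sum_(i <= nu) g_i w^i, a polynomial in w = z^-1. *)
Definition Gminus_poly (R : realType) (nu : nat) (g : nat -> R) : {poly R} :=
  \poly_(i < nu.+1) g i.

Definition polyCval (R : realType) (p : {poly R}) (w : R[i]) : R[i] :=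
  (map_poly (real_complex R) p).[w].

(* A rational transfer function pnum / pden in w = z^-1, of relative degree 1,
   factored as w * (Gplus_num / pden) * G^-.  Since w = z^-1, a pole or zero
   lies in the open unit disc of the z-plane iff the corresponding root w
   satisfies 1 < |w|.  Stability and causality are [pden_stable] (it forces
   pden(0) != 0); G^+ = Gplus_num / pden has a stable causal inverse by
   [Gplus_stable].  By the last three fields G^- has exactly nu zeros, all of
   them unstable (|z| >= 1), and no pure delay. *)
Record plant (R : realType) := Plant {
  pnum : {poly R};
  pden : {poly R};
  Gplus_num : {poly R};
  nu : nat;
  gcoef : nat -> R;
  plant_factored : pnum = 'X * Gplus_num * Gminus_poly nu gcoef;
  pden_stable : forall w : R[i], polyCval pden w = 0 -> 1 < modulus w;
  Gplus_stable : forall w : R[i], polyCval Gplus_num w = 0 -> 1 < modulus w;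
  g0_neq0 : gcoef 0%N != 0;
  gnu_neq0 : gcoef nu != 0;
  Gminus_unstable : forall w : R[i],
    polyCval (Gminus_poly nu gcoef) w = 0 -> modulus w <= 1
}.

(* The coefficients of z^i and z^-i are both [zcoef i]; the normalization is on
   the one-sided sum of the coefficients, not on the value of the filter at
   z = 1. *)
Record zero_phase_filter (R : realType) := ZeroPhase {
  zorder : nat;
  zcoef : nat -> R;
  zcoef_sum1 : \sum_(0 <= i < zorder.+1) zcoef i = 1
}.

Record learning_filters (R : realType) := LearningFilters {
  alpha : R;
  Qu : zero_phase_filter R;
  Qe : zero_phase_filter R
}.

Definition filter_eval (R : realType) (Q : zero_phase_filter R) (z : R[i]) :
    R[i] :=
  (zcoef Q 0)%:C
  + \sum_(1 <= i < (zorder Q).+1) (zcoef Q i)%:C * (z ^+ i + z ^- i).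

(* G^-(w): evaluated at w = z^-1 for G^-(z^-1), and at w = z for G^-(z). *)
Definition Gminus_eval (R : realType) (P : plant R) (w : R[i]) : R[i] :=
  polyCval (Gminus_poly (nu P) (gcoef P)) w.

(* e^(- j theta) *)
Definition expNj (R : realType) (theta : R) : R[i] :=
  (cos theta) -i* (sin theta).

(* For F continuous on the unit circle this supremum is a maximum. *)
Definition Hinf_norm (R : realType) (F : R[i] -> R[i]) : R :=
  sup [set modulus (F (expNj theta)) | theta in `[0, (pi : R)]].

Definition H_condition (R : realType) (P : plant R) (L : learning_filters R) :
    Prop :=
  Hinf_norm (fun z => filter_eval (Qu L) z
    - (alpha L)%:C * filter_eval (Qe L) z
        * Gminus_eval P z^-1 * Gminus_eval P z) < 1.

(* Matrix indices start at 0 instead of 1; every entry depends only on the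
   difference of the indices, so the formulas are unchanged. *)

Definition Gminus_mx (R : realType) (P : plant R) (n : nat) :
    'M[R]_(n + 2 * nu P) :=
  \matrix_(i, j) (if (j <= i <= j + nu P)%N then gcoef P (i - j)%N else 0).

Definition filter_mx (R : realType) (Q : zero_phase_filter R) (m : nat) :
    'M[R]_m :=
  \matrix_(i, j) (if (`|i - j| <= zorder Q)%N then zcoef Q `|i - j|%N else 0).

Definition pad_mx (R : realType) (P : plant R) (n : nat) :
    'M[R]_(n + 2 * nu P, n) :=
  \matrix_(i, j) (if i == (j + nu P)%N :> nat then 1 else 0).

Definition learning_mx (R : realType) (P : plant R) (L : learning_filters R)
    (n : nat) : 'M[R]_(n, n + 2 * nu P) :=
  alpha L *: ((pad_mx P n)^T *m (Gminus_mx P n)^T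
              *m filter_mx (Qe L) (n + 2 * nu P)).

Definition transition_mx (R : realType) (P : plant R) (L : learning_filters R)
    (n : nat) : 'M[R]_n :=
  filter_mx (Qu L) n
  - alpha L *: ((pad_mx P n)^T *m (Gminus_mx P n)^T
                *m filter_mx (Qe L) (n + 2 * nu P)
                *m Gminus_mx P n *m pad_mx P n).

Definition output (R : realType) (P : plant R) (n : nat) (u : 'cV[R]_n) :
    'cV[R]_(n + 2 * nu P) :=
  Gminus_mx P n *m pad_mx P n *m u.

Definition tracking_error (R : realType) (P : plant R) (n : nat)
    (r : 'cV[R]_(n + 2 * nu P)) (u : 'cV[R]_n) : 'cV[R]_(n + 2 * nu P) :=
  r - output P u.

Definition update (R : realType) (P : plant R) (L : learning_filters R)
    (n : nat) (r : 'cV[R]_(n + 2 * nu P)) (u : 'cV[R]_n) : 'cV[R]_n :=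
  filter_mx (Qu L) n *m u + learning_mx P L n *m tracking_error r u.

Lemma update_transition (R : realType) (P : plant R) (L : learning_filters R)
    (n : nat) (r : 'cV[R]_(n + 2 * nu P)) (u : 'cV[R]_n) :
  update L r u = transition_mx P L n *m u + learning_mx P L n *m r.
Proof.
rewrite /update /tracking_error /output /learning_mx /transition_mx.
rewrite mulmxBr mulmxBl -!scalemxAl !mulmxA.
by rewrite [X in _ + X]addrC addrA.
Qed.

(* lambda_1, ..., lambda_n: the complex eigenvalues, listed with their algebraic
   multiplicities. *)
Definition eigenvalues (R : realType) (n : nat) (A : 'M[R]_n) : seq R[i] :=
  sval (closed_field_poly_normal (char_poly (map_mx (real_complex R) A))).

Lemma char_poly_eigenvalues (R : realType) (n : nat) (A : 'M[R]_n) :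
  char_poly (map_mx (real_complex R) A)
  = \prod_(l <- eigenvalues A) ('X - l%:P).
Proof.
rewrite /eigenvalues; case: closed_field_poly_normal => s /= {1}->.
by rewrite (monicP (char_poly_monic _)) scale1r.
Qed.

Lemma size_eigenvalues (R : realType) (n : nat) (A : 'M[R]_n) :
  size (eigenvalues A) = n.
Proof.
have := size_char_poly (map_mx (real_complex R) A).
by rewrite char_poly_eigenvalues size_prod_XsubC => -[].
Qed.

Lemma mem_eigenvalues (R : realType) (n : nat) (A : 'M[R]_n) (l : R[i]) :
  (l \in eigenvalues A) = eigenvalue (map_mx (real_complex R) A) l.
Proof. by rewrite eigenvalue_root_char char_poly_eigenvalues root_prod_XsubC. Qed.

(* max_m |lambda_m(A)|; the default 0 is harmless as moduli are nonnegative,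
   and is the value for the empty matrix. *)
Definition spectral_radius (R : realType) (n : nat) (A : 'M[R]_n) : R :=
  \big[Num.max/0]_(l <- eigenvalues A) modulus l.

Definition iteration_convergence (R : realType) (P : plant R)
    (L : learning_filters R) (n : nat) : Prop :=
  spectral_radius (transition_mx P L n) < 1.

(* Main.v *)
Require Import Defs.
From mathcomp Require Import all_boot all_order all_solvable all_algebra all_field.
From mathcomp Require Import all_classical all_reals all_analysis.
From mathcomp Require Import complex zify ring.
Import Order.TTheory GRing.Theory Num.Theory.
Import numFieldNormedType.Exports.
Local Open Scope classical_set_scope.
Local Open Scope sesquilinear_scope.
Local Open Scope ring_scope.

(** The transition matrix is the n x n section of a Toeplitz matrix whose
    symbol is F(z) = Q_u - alpha Q_e G^-(1/z) G^-(z): the nu zeros padded on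
    each side leave room for the full convolution with G^-, so the product
    N^T (G^-)^T Q_e G^- N has no boundary effect ([transition_mxE],
    [learning_laurent]).  Both parts of the theorem follow from

      |F|_oo - K / n  <=  spectral radius of A_n  <=  |F|_oo,

    where K depends on F only.

    Upper bound ([toeplitz_eigenvalue_le]).  Let V(z) be the sum of the
    v_i z^-i, and let m be at least n plus the degree of F.  Averaging
    F |V|^2 over the m-th roots of unity yields exactly the form v A v^*
    ([toeplitz_quadrature]); F = 1 gives the Parseval identity.  If v is an
    eigenvector for l, then l |v|^2 is an average of F |V|^2, of modulus at
    most |F|_oo |v|^2.

    Lower bound ([symbol_le_eigenvalues]).  On the vector (1, z, ..., z^(n-1))
    with |z| = 1, the form A_n takes the value n F(z) up to an error that is
    bounded independently of n and z: the e-th diagonal has n - |e| entries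
    instead of n ([toeplitz_wave]).  As A_n is hermitian, the modulus of the form
    is at most n times the spectral radius ([hermitian_form_le]).

    The supremum over theta in [0, pi] is a supremum over the whole circle
    because F(1/z) = F(z).  The limit of the spectral radii is thus |F|_oo, and
    it is less than 1 if and only if (H) holds. *)

(** * Toeplitz matrices of Laurent polynomials *)

Section LaurentToeplitz.
Set Implicit Arguments.
Unset Strict Implicit.
Context {C : numClosedFieldType}.
Implicit Types (s : seq (C * int)) (z w : C) (d : int).

(** A Laurent polynomial is given as a list of terms (coefficient, exponent),
    with repeated exponents allowed: quadratic forms are then sums over the
    terms, and products by a monomial need no renumbering. *)
Definition coefficient s d : C := \sum_(t <- s) t.1 *+ (t.2 == d).

Definition symbol s z : C := \sum_(t <- s) t.1 * z ^ t.2.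

Definition toeplitz (c : int -> C) n : 'M[C]_n := \matrix_(i, j) c (i%:Z - j%:Z).

Lemma conj_unit_circle z : `|z| = 1 -> z^* = z^-1.
Proof. by move=> z1; rewrite invC_norm z1 expr1n invr1 mul1r. Qed.

Lemma unit_circle_neq0 z : `|z| = 1 -> z != 0.
Proof. by move=> z1; rewrite -normr_eq0 z1 oner_neq0. Qed.

Lemma norm_exprz z d : `|z ^ d| = `|z| ^ d.
Proof.
by case: d => k; rewrite ?NegzE -?exprnN -?exprnP ?normfV ?normrX.
Qed.

Lemma quadratic_formE n (A : 'M[C]_n) (u : 'rV[C]_n) :
  (u *m A *m u ^t*) 0 0 = \sum_i \sum_j u 0 i * A i j * (u 0 j)^*.
Proof.
rewrite mxE exchange_big; apply: eq_bigr => j _ /=.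
by rewrite !mxE mulr_suml.
Qed.

Lemma square_norm_formE n (u : 'rV[C]_n) :
  (u *m u ^t*) 0 0 = \sum_i `|u 0 i| ^+ 2.
Proof. by rewrite mxE; apply: eq_bigr => i _; rewrite !mxE normCK. Qed.

Lemma prim_root_exists n : (0 < n)%N -> {w : C | n.-primitive_root w}.
Proof.
pose p : {poly C} := 'X^n - 1; have [r Dp] := closed_field_poly_normal p.
move=> n_gt0; apply/sigW; rewrite (monicP _) ?monicXnsubC // scale1r in Dp.
have rn1 : all n.-unity_root r by apply/allP=> z; rewrite -root_prod_XsubC -Dp.
have sz_r : (n < (size r).+1)%N.
  by rewrite -(size_prod_XsubC r id) -Dp size_XnsubC.
have [|z] := hasP (has_prim_root n_gt0 rn1 _ sz_r); last by exists z.
by rewrite -separable_prod_XsubC -Dp separable_Xn_sub_1 // pnatr_eq0 -lt0n.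
Qed.

Lemma norm_prim_root m w : m.-primitive_root w -> `|w| = 1.
Proof.
move=> wP; apply/eqP; rewrite -(pexpr_eq1 (prim_order_gt0 wP)) ?normr_ge0 //.
by rewrite -normrX (prim_expr_order wP) normr1.
Qed.

(** For d != 0 the geometric sum vanishes because w ^ d != 1, which is where
    |d| < m is needed. *)
Lemma sum_prim_root m w d : m.-primitive_root w -> (`|d| < m)%N ->
  \sum_(k < m) (w ^+ k) ^ d = m%:R *+ (d == 0).
Proof.
move=> wP dm; have w0 := unit_circle_neq0 (norm_prim_root wP).
have [->|d0] := eqVneq d 0.
  rewrite mulr1n (eq_bigr (fun=> 1)); last by move=> k _; rewrite expr0z.
  by rewrite sumr_const card_ord.
rewrite mulr0n.
have wd1 : w ^ d - 1 != 0.
  rewrite subr_eq0; apply/eqP => wd.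
  have /eqP : w ^+ `|d|%N = 1.
    case: d wd {dm d0} => [k|k]; first by rewrite -exprnP.
    by rewrite NegzE -exprnN abszN => /(congr1 GRing.inv); rewrite invrK invr1.
  rewrite -(prim_order_dvd wP) gtnNdvd // lt0n absz_eq0 //.
apply: (mulfI wd1); rewrite mulr0.
under eq_bigr => k _ do rewrite exprnP exprzAC -exprnP.
by rewrite -subrX1 exprnP exprzAC -exprnP (prim_expr_order wP) exp1rz subrr.
Qed.

(** The product of the symbol and of the squared modulus of the trigonometric
    polynomial of u is a Laurent polynomial with exponents less than m in
    absolute value; averaging over the m-th roots of unity extracts its
    constant coefficient, which is the quadratic form. *)
Lemma toeplitz_quadrature s n m w (u : 'rV[C]_n) :
    m.-primitive_root w -> (forall t, t \in s -> (n + `|t.2| <= m)%N) ->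
  m%:R * (u *m toeplitz (coefficient s) n *m u ^t*) 0 0
  = \sum_(k < m) symbol s (w ^+ k) * `|\sum_i u 0 i * (w ^+ k) ^ (- i%:Z)| ^+ 2.
Proof.
move=> wP sm; have w1 := norm_prim_root wP.
have wk1 k : `|w ^+ k| = 1 by rewrite normrX w1 expr1n.
have wk0 k : w ^+ k != 0 by rewrite unit_circle_neq0.
rewrite quadratic_formE.
transitivity (\sum_i \sum_j \sum_(t <- s) \sum_(k < m)
    (t.1 * (w ^+ k) ^ t.2)
    * (u 0 i * (w ^+ k) ^ (- i%:Z) * ((u 0 j)^* * (w ^+ k) ^ j%:Z))).
  rewrite mulr_sumr; apply: eq_bigr => i _; rewrite mulr_sumr.
  apply: eq_bigr => j _; rewrite mxE mulrAC mulrA mulr_sumr.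
  rewrite !big_seq; apply: eq_bigr => t ts.
  under eq_bigr => k _.
    rewrite (_ : _ * _ = t.1 * u 0 i * (u 0 j)^*
                         * (w ^+ k) ^ (t.2 + (- i%:Z + j%:Z))); last first.
      rewrite !expfzDr //; 
      move: ((w ^+ k) ^ t.2) ((w ^+ k) ^ (- i%:Z)) ((w ^+ k) ^ j%:Z).
      by move: ((u 0 j)^*) => a b c e; ring.
    over.
  rewrite -mulr_sumr (sum_prim_root wP); last first.
    by have := sm t ts; have := ltn_ord i; have := ltn_ord j; lia.
  (* Only the diagonal i - j = t.2 survives the averaging. *)
  have -> : (t.2 + (- i%:Z + j%:Z) == 0) = (t.2 == i%:Z - j%:Z) by lia.
  case: (t.2 == _); last by rewrite !mulr0n !mulr0.
  rewrite !mulr1n; move: ((u 0 j)^*) (m%:R : C) => a b; ring.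
under eq_bigr => i _.
  under eq_bigr => j _ do rewrite exchange_big.
  rewrite exchange_big /=; over.
rewrite exchange_big /=; apply: eq_bigr => k _.
rewrite normCK rmorph_sum /= big_distrlr /= mulr_sumr; apply: eq_bigr => i _.
rewrite mulr_sumr; apply: eq_bigr => j _; rewrite -mulr_suml; congr (_ * (_ * _)).
by rewrite rmorphM /= fmorphXz /= (conj_unit_circle (wk1 k)) exprz_inv opprK.
Qed.

(** For an eigenvector v, the quadrature writes l |v|^2 as an average of the
    symbol with nonnegative weights of total |v|^2. *)
Lemma toeplitz_eigenvalue_le s n (B l : C) :
    (forall z, `|z| = 1 -> `|symbol s z| <= B) ->
  eigenvalue (toeplitz (coefficient s) n) l -> `|l| <= B.
Proof.
move=> sB /eigenvalueP[v vA v0].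
pose m := (n + \sum_(t <- s) `|t.2|).+1%N.
have [w wP] := prim_root_exists (ltn0Sn _ : (0 < m)%N).
have sm t : t \in s -> (n + `|t.2| <= m)%N.
  by move=> ts; rewrite leqW // leq_add2l (big_rem t ts) leq_addr.
have w1 k : `|w ^+ k| = 1 by rewrite normrX (norm_prim_root wP) expr1n.
have N_gt0 : 0 < (v *m v ^t*) 0 0.
  rewrite square_norm_formE lt_def sumr_ge0 ?andbT; last first.
    by move=> i _; rewrite exprn_ge0.
  apply: contra v0; rewrite psumr_eq0; last by move=> i _; rewrite exprn_ge0.
  move=> /allP v0; apply/eqP/rowP => i; rewrite mxE; apply/eqP.
  by have := v0 i (mem_index_enum i); rewrite sqrf_eq0 normr_eq0.
have m_gt0 : 0 < m%:R :> C by rewrite ltr0n.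
(* The quadrature for the constant symbol 1, whose matrix is the identity. *)
have parseval : m%:R * (v *m v ^t*) 0 0
    = \sum_(k < m) `|\sum_i v 0 i * (w ^+ k) ^ (- i%:Z)| ^+ 2.
  have := @toeplitz_quadrature [:: (1, 0)] n m w v wP.
  have -> : toeplitz (coefficient [:: (1, 0)]) n = 1%:M.
    apply/matrixP => i j; rewrite !mxE /coefficient big_seq1 /=.
    by congr (_ *+ nat_of_bool _); rewrite -val_eqE /=; lia.
  rewrite mulmx1 => ->; last first.
    by move=> t; rewrite inE => /eqP -> /=; rewrite addn0 leqW // leq_addr.
  by apply: eq_bigr => k _; rewrite /symbol big_seq1 /= expr0z !mul1r.
rewrite -(ler_pM2r (mulr_gt0 m_gt0 N_gt0)).
rewrite -{1}(ger0_norm (ltW (mulr_gt0 m_gt0 N_gt0))) -normrM mulrCA.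
have -> : l * (v *m v ^t*) 0 0
    = (v *m toeplitz (coefficient s) n *m v ^t*) 0 0.
  by rewrite vA -scalemxAl [RHS]mxE.
rewrite (toeplitz_quadrature v wP sm) parseval mulr_sumr.
apply: le_trans (ler_norm_sum _ _ _) _; apply: ler_sum => k _.
by rewrite normrM [X in _ * X <= _]ger0_norm ?exprn_ge0 // ler_wpM2r ?exprn_ge0 ?sB.
Qed.

(** The d-th diagonal of an n x n matrix has n - |d| entries, or none if
    |d| > n. *)
Lemma sum_diagonal n d :
  `|\sum_(i < n) \sum_(j < n) (d == i%:Z - j%:Z)%:R - n%:R| <= `|d|%N%:R :> C.
Proof.
have geq_count e k : (\sum_(i < k) (e <= i) = k - e)%N.
  elim: k => [|k IH]; first by rewrite big_ord0.
  by rewrite big_ord_recr /= IH; lia.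
have diag e : (\sum_(i < n) \sum_(j < n) ((i : nat) == j + e)%N = n - e)%N.
  rewrite -geq_count; apply: eq_bigr => i _.
  have [ei|ie] := leqP e i; last first.
    by rewrite big1 // => j _; apply/eqP; rewrite eqb0; lia.
  have jn : (i - e < n)%N by have := ltn_ord i; lia.
  rewrite (bigD1 (Ordinal jn)) //= subnK // eqxx big1 ?addn0 // => j.
  by rewrite -val_eqE /= => ?; apply/eqP; rewrite eqb0; lia.
have -> : \sum_(i < n) \sum_(j < n) (d == i%:Z - j%:Z)%:R
    = (n - `|d|)%N%:R :> C.
  case: d => e.
    rewrite -[(n - `|_|)%N](diag e) natr_sum; apply: eq_bigr => i _.
    by rewrite natr_sum; apply: eq_bigr => j _; congr (nat_of_bool _)%:R; lia.
  rewrite -[(n - `|_|)%N](diag e.+1) exchange_big natr_sum /=.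
  apply: eq_bigr => i _; rewrite natr_sum; apply: eq_bigr => j _.
  by congr (nat_of_bool _)%:R; lia.
have [dn|nd] := leqP `|d|%N n.
  by rewrite natrB // addrAC subrr sub0r normrN normr_nat.
by rewrite (eqP (ltnW nd)) sub0r normrN normr_nat ler_nat ltnW.
Qed.

(** A wave of frequency z is an eigenvector of the bi-infinite Toeplitz matrix,
    for the eigenvalue F(z).  Truncation to n entries shortens the diagonal of
    the term t by at most |t.2| entries, so the error does not grow with n. *)
Lemma toeplitz_wave s n z : `|z| = 1 ->
  `|((\row_(i < n) z ^+ i) *m toeplitz (coefficient s) n
       *m (\row_(i < n) z ^+ i) ^t*) 0 0 - n%:R * symbol s z|
  <= \sum_(t <- s) `|t.1| * `|t.2|%N%:R.
Proof.
move=> z1; have z0 := unit_circle_neq0 z1.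
rewrite quadratic_formE.
have -> : \sum_i \sum_j (\row_(i < n) z ^+ i) 0 i
      * toeplitz (coefficient s) n i j * ((\row_(i < n) z ^+ i) 0 j)^*
    = \sum_(t <- s) t.1 * z ^ t.2
        * \sum_(i < n) \sum_(j < n) (t.2 == i%:Z - j%:Z)%:R.
  under [RHS]eq_bigr => t _.
    rewrite mulr_sumr; under eq_bigr => i _ do rewrite mulr_sumr; over.
  rewrite [RHS]exchange_big /=; apply: eq_bigr => i _.
  rewrite [RHS]exchange_big /=; apply: eq_bigr => j _; rewrite !mxE.
  rewrite mulrAC mulr_sumr; apply: eq_bigr => t _.
  have [->|_] := eqVneq t.2 _; last by rewrite mulr0n !mulr0.
  rewrite mulr1n mulr1 mulrC rmorphXn /= conj_unit_circle //.
  by rewrite expfzDr // -exprnN exprVn -exprnP.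
rewrite /symbol mulr_sumr -sumrB.
apply: le_trans (ler_norm_sum _ _ _) _; apply: ler_sum => t _.
rewrite [n%:R * _]mulrC -mulrBr normrM; apply: ler_pM => //; last exact: sum_diagonal.
have -> : `|t.1 * z ^ t.2| = `|t.1|; last by [].
by rewrite normrM norm_exprz z1 exp1rz mulr1.
Qed.

(** In an orthonormal basis of eigenvectors the form is the sum of the
    d_k |w_k|^2, where the d_k are eigenvalues. *)
Lemma hermitian_form_le n (A : 'M[C]_n) (B : C) (u : 'rV[C]_n) :
    A \is hermsymmx -> (forall l, eigenvalue A l -> `|l| <= B) ->
  `|(u *m A *m u ^t*) 0 0| <= B * (u *m u ^t*) 0 0.
Proof.
move=> /hermitian_normalmx/orthomx_spectralP; set P := spectralmx A.
set d := spectral_diag A => AE lB.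
have PU : P \in unitmx := spectral_unit A.
have Pt : invmx P = P ^t* by rewrite invmx_unitary ?spectral_unitarymx.
have dB k : `|d 0 k| <= B.
  apply/lB/eigenvalueP; exists (row k P).
    rewrite {1}AE -row_mul !mulmxA mulmxV // mul1mx row_mul.
    by rewrite row_diag_mx -scalemxAl -rowE.
  apply/eqP => /(congr1 (mulmx^~ (invmx P))); rewrite mul0mx -row_mul mulmxV //.
  by move=> /rowP/(_ k)/eqP; rewrite !mxE eqxx oner_eq0.
pose v := u *m P ^t*.
have vt : v ^t* = P *m u ^t* by rewrite /v trmx_mul map_mxM trmxCK.
have -> : u *m A *m u ^t* = v *m diag_mx d *m v ^t*.
  by rewrite vt {1}AE Pt /v !mulmxA.
have -> : u *m u ^t* = v *m v ^t*.
  by rewrite vt /v mulmxA -(mulmxA u) -Pt mulVmx // mulmx1.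
rewrite square_norm_formE mxE mulr_sumr.
apply: le_trans (ler_norm_sum _ _ _) _; apply: ler_sum => k _.
rewrite mul_mx_diag !mxE mulrAC -normCK normrM normrX normr_id mulrC.
by rewrite ler_wpM2r ?exprn_ge0.
Qed.

Lemma symbol_le_eigenvalues s n (B z : C) :
    toeplitz (coefficient s) n \is hermsymmx ->
    (forall l, eigenvalue (toeplitz (coefficient s) n) l -> `|l| <= B) ->
    `|z| = 1 ->
  n%:R * `|symbol s z| <= n%:R * B + \sum_(t <- s) `|t.1| * `|t.2|%N%:R.
Proof.
move=> Ah AB z1; have := hermitian_form_le (\row_(i < n) z ^+ i) Ah AB.
have -> : ((\row_(i < n) z ^+ i) *m (\row_(i < n) z ^+ i) ^t*) 0 0 = n%:R :> C.
  rewrite square_norm_formE (eq_bigr (fun=> 1)) ?sumr_const ?card_ord //.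
  by move=> i _; rewrite !mxE normrX z1 !expr1n.
rewrite mulrC => le1; have := lerD le1 (toeplitz_wave s n z1).
apply: le_trans; rewrite -[X in X * _]normr_nat -normrM.
set y := (_ *m _ *m _) 0 0; set x := n%:R * _.
by have := ler_normB y (y - x); rewrite subKr.
Qed.

End LaurentToeplitz.

(** * Calculus of symbols *)

Section LaurentClosure.
Set Implicit Arguments.
Unset Strict Implicit.
Context {C : numClosedFieldType}.
Implicit Types (c : int -> C) (F : C -> C).

Lemma exprz_subn (z : C) (a b : nat) : z != 0 -> z ^ (b%:Z - a%:Z) = z^-1 ^+ a * z ^+ b.
Proof. by move=> z0; rewrite expfzDr // mulrC -exprnN exprVn -exprnP. Qed.

(** The origin is excluded because negative exponents occur. *)
Definition laurent c F := exists s : seq (C * int),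
  (forall d, coefficient s d = c d) /\ (forall z, z != 0 -> symbol s z = F z).

Lemma eq_laurent c c' F F' : c =1 c' -> (forall z, z != 0 -> F z = F' z) ->
  laurent c F -> laurent c' F'.
Proof.
by move=> cc' FF' [s [sc sF]]; exists s; split=> [d|z z0]; rewrite -?cc' -?FF' ?sF.
Qed.

Lemma laurent0 : laurent (fun=> 0) (fun=> 0).
Proof. by exists [::]; split=> *; rewrite /coefficient /symbol big_nil. Qed.

Lemma laurent_exprz e : laurent (fun d => (d == e)%:R) (fun z => z ^ e).
Proof.
exists [:: (1, e)]; split=> [d|z _]; rewrite /coefficient /symbol big_seq1 /=.
  by rewrite eq_sym.
by rewrite mul1r.
Qed.

Lemma laurentD c1 c2 F1 F2 : laurent c1 F1 -> laurent c2 F2 ->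
  laurent (fun d => c1 d + c2 d) (fun z => F1 z + F2 z).
Proof.
move=> [s1 [sc1 sF1]] [s2 [sc2 sF2]]; exists (s1 ++ s2); split=> [d|z z0].
  by rewrite /coefficient big_cat -sc1 -sc2.
by rewrite /symbol big_cat -sF1 // -sF2.
Qed.

Lemma laurentZ a c F : laurent c F -> laurent (fun d => a * c d) (fun z => a * F z).
Proof.
move=> [s [sc sF]]; exists [seq (a * t.1, t.2) | t <- s]; split=> [d|z z0].
  rewrite /coefficient big_map -sc mulr_sumr; apply: eq_bigr => t _ /=.
  by rewrite mulrnAr.
rewrite /symbol big_map -sF // mulr_sumr; apply: eq_bigr => t _ /=.
by rewrite mulrA.
Qed.

Lemma laurent_shift e c F : laurent c F ->
  laurent (fun d => c (d - e)) (fun z => z ^ e * F z).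
Proof.
move=> [s [sc sF]]; exists [seq (t.1, t.2 + e) | t <- s]; split=> [d|z z0].
  rewrite /coefficient big_map -sc; apply: eq_bigr => t _ /=.
  by rewrite [in RHS]eq_sym subr_eq eq_sym.
rewrite /symbol big_map -sF // mulr_sumr; apply: eq_bigr => t _ /=.
by rewrite mulrCA expfzDr // [z ^ e * _]mulrC.
Qed.

Lemma laurent_sum I (r : seq I) (c : I -> int -> C) (F : I -> C -> C) :
    (forall i, laurent (c i) (F i)) ->
  laurent (fun d => \sum_(i <- r) c i d) (fun z => \sum_(i <- r) F i z).
Proof.
move=> cF; elim: r => [|i r IH].
  by apply: eq_laurent laurent0 => [d|z _] /=; rewrite big_nil.
by apply: eq_laurent (laurentD (cF i) IH) => [d|z _] /=; rewrite big_cons.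
Qed.

End LaurentClosure.

(** * The transition matrix and its symbol *)

Section LearningSymbol.
Set Implicit Arguments.
Unset Strict Implicit.
Context {R : realType}.
Implicit Types (P : plant R) (L : learning_filters R) (Q : zero_phase_filter R).
Local Open Scope complex_scope.

Definition filter_coef Q (d : int) : R :=
  if (`|d| <= zorder Q)%N then zcoef Q `|d|%N else 0.

Definition learning_symbol P L (z : R[i]) : R[i] :=
  filter_eval (Qu L) z
    - (alpha L)%:C * filter_eval (Qe L) z * Gminus_eval P z^-1 * Gminus_eval P z.

Definition learning_coef P L (d : int) : R :=
  filter_coef (Qu L) d - alpha L *
    \sum_(a < (nu P).+1) \sum_(b < (nu P).+1)
      gcoef P a * gcoef P b * filter_coef (Qe L) (d + a%:Z - b%:Z).

(** For d != 0 exactly one of the exponents i and - i can equal d, and it does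
    so for i = |d|; the constant term is kept apart, as it has no mirror
    image. *)
Lemma filter_laurent Q : laurent (fun d => (filter_coef Q d)%:C) (filter_eval Q).
Proof.
have term (i : nat) : laurent
    (fun d : int => (zcoef Q i)%:C * ((d == i%:Z)%:R + (d == - i%:Z)%:R))
    (fun z : R[i] => (zcoef Q i)%:C * (z ^+ i + z ^- i)).
  apply: laurentZ; apply: eq_laurent (laurentD (laurent_exprz i%:Z)
    (laurent_exprz (- i%:Z))) => // z _.
  by rewrite -exprnP -exprnN.
have cst : laurent (fun d : int => (zcoef Q 0%N)%:C * (d == 0)%:R)
                   (fun z : R[i] => (zcoef Q 0%N)%:C * z ^ (0 : int)).
  exact/laurentZ/laurent_exprz.
apply: eq_laurent (laurentD cst (laurent_sum (index_iota 1 (zorder Q).+1) term)).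
  move=> d; transitivity (\sum_(0 <= i < (zorder Q).+1 | i == `|d|%N) (zcoef Q i)%:C).
    rewrite [RHS]big_mkcond big_ltn //=; congr (_ + _).
      have [->|d0] := eqVneq d 0; first by rewrite mulr1.
      by rewrite mulr0 eq_sym absz_eq0 (negbTE d0).
    apply: eq_big_nat => i i1; have [id|id] := eqVneq i `|d|%N.
      by rewrite -natrD (_ : (_ + _)%N = 1%N) ?mulr1 //; move: id; lia.
    rewrite -natrD (_ : (_ + _)%N = 0%N) ?mulr0 //.
    by move: id; lia.
  by rewrite big_nat1_eq /filter_coef /= ltnS; case: ifP; rewrite ?rmorph0.
by move=> z _; rewrite expr0z mulr1.
Qed.

Lemma Gminus_evalE P w :
  Gminus_eval P w = \sum_(i < (nu P).+1) (gcoef P i)%:C * w ^+ i.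
Proof.
rewrite /Gminus_eval /polyCval /Gminus_poly.
have -> : map_poly (real_complex R) (\poly_(i < (nu P).+1) gcoef P i)
    = \poly_(i < (nu P).+1) (gcoef P i)%:C.
  by apply/polyP => i; rewrite coef_map !coef_poly; case: ifP => // _; rewrite rmorph0.
exact: horner_poly.
Qed.

(** The product G^-(1/z) G^-(z) is a double sum of monomials z^(b - a), each of
    which shifts the coefficients of Q_e. *)
Lemma learning_laurent P L :
  laurent (fun d => (learning_coef P L d)%:C) (learning_symbol P L).
Proof.
have term (a b : 'I_(nu P).+1) : laurent
    (fun d => (gcoef P a * gcoef P b)%:C
              * (filter_coef (Qe L) (d - (b%:Z - a%:Z)))%:C)
    (fun z => (gcoef P a * gcoef P b)%:C
              * (z ^ (b%:Z - a%:Z) * filter_eval (Qe L) z)).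
  exact/laurentZ/(@laurent_shift _ _ (fun d => (filter_coef (Qe L) d)%:C))/filter_laurent.
have sums := laurent_sum (index_enum _) (fun a => laurent_sum (index_enum _) (term a)).
apply: eq_laurent (laurentD (filter_laurent (Qu L)) (laurentZ (- (alpha L)%:C) sums)).
  move=> d; rewrite /learning_coef rmorphB rmorphM mulNr rmorph_sum /=.
  congr (_ - _ * _); apply: eq_bigr => a _; rewrite rmorph_sum /=.
  apply: eq_bigr => b _; rewrite [RHS]rmorphM /=; congr (_ * (filter_coef _ _)%:C).
  by lia.
move=> z z0; rewrite /learning_symbol mulNr -!mulrA; congr (_ - _ * _).
rewrite !Gminus_evalE big_distrlr /= [RHS]mulrC mulr_suml.
apply: eq_bigr => a _; rewrite mulr_suml; apply: eq_bigr => b _.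
by rewrite [LHS]mulrA; congr (_ * _); rewrite rmorphM exprz_subn //= mulrACA.
Qed.

(** Column i of G^- N carries g_0, ..., g_nu in the rows i + nu, ..., i + 2 nu.
    These are rows of the matrix for every i < n: this is what the padding is
    for, and why no column is truncated. *)
Lemma padded_plant_sum P n (i : 'I_n) (h : nat -> R) :
  \sum_(k < n + 2 * nu P) (Gminus_mx P n *m pad_mx P n) k i * h k
  = \sum_(a < (nu P).+1) gcoef P a * h (i + nu P + a)%N.
Proof.
set p := (i + nu P)%N.
have p_lt : (p < n + 2 * nu P)%N by have := ltn_ord i; rewrite /p; lia.
transitivity (\sum_(0 <= k < n + 2 * nu P)
    (if (p <= k <= p + nu P)%N then gcoef P (k - p)%N else 0) * h k).
  rewrite big_mkord; apply: eq_bigr => k _; congr (_ * _).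
  rewrite mxE (bigD1 (Ordinal p_lt)) //= !mxE eqxx mulr1 big1 ?addr0 // => l.
  by rewrite -val_eqE /= !mxE => /negbTE ->; rewrite mulr0.
rewrite (big_cat_nat _ (n := p)) ?(ltnW p_lt) //=.
rewrite (big_cat_nat _ (m := p) (n := (p + (nu P).+1)%N)) ?leq_addr //=; last first.
  by have := ltn_ord i; rewrite /p; lia.
rewrite [X in X + _]big_nat [X in X + _]big1 ?add0r; last first.
  by move=> k kp; rewrite ifF ?mul0r //; lia.
rewrite [X in _ + X]big_nat [X in _ + X]big1 ?addr0; last first.
  by move=> k kp; rewrite ifF ?mul0r //; lia.
rewrite -{1}[p]add0n big_addn addKn big_mkord; apply: eq_bigr => a _.
rewrite ifT ?addnK 1?[(p + a)%N]addnC //.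
by have := ltn_ord a; lia.
Qed.

Lemma transition_mxE P L n (i j : 'I_n) :
  transition_mx P L n i j = learning_coef P L (i%:Z - j%:Z).
Proof.
rewrite /transition_mx -trmx_mul -mulmxA !mxE; congr (_ - _ * _).
under eq_bigr => l _.
  rewrite [X in X * _]mxE.
  under eq_bigr => k _ do rewrite [X in X * _]mxE [X in _ * X]mxE
    -/(filter_coef (Qe L) (k%:Z - l%:Z)).
  rewrite (padded_plant_sum P i (fun k => filter_coef (Qe L) (k%:Z - l%:Z))) mulrC; over.
rewrite (padded_plant_sum P j (fun l => \sum_(a < (nu P).+1)
  gcoef P a * filter_coef (Qe L) ((i + nu P + a)%N%:Z - l%:Z))).
rewrite exchange_big /=; apply: eq_bigr => b _; rewrite mulr_sumr.
apply: eq_bigr => a _; rewrite mulrCA mulrA; congr (_ * filter_coef _ _).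
by lia.
Qed.

Lemma trmx_filter_mx Q m : (filter_mx Q m)^T = filter_mx Q m.
Proof. by apply/matrixP => i j; rewrite !mxE distnC. Qed.

Lemma transition_mx_sym P L n : (transition_mx P L n)^T = transition_mx P L n.
Proof.
rewrite /transition_mx linearB /= linearZ /= !trmx_mul !trmxK !trmx_filter_mx.
by rewrite !mulmxA.
Qed.

Lemma transition_mx_hermitian P L n :
  map_mx (real_complex R) (transition_mx P L n) \is hermsymmx.
Proof.
apply: realsym_hermsym.
  apply/is_hermitianmxP; rewrite expr0 scale1r -[in LHS]transition_mx_sym.
  by apply/matrixP => i j; rewrite !mxE.
by apply/mxOverP => i j; rewrite mxE complex_real eqxx.
Qed.

Lemma transition_mx_toeplitz P L (s : seq (R[i] * int)) n :
    (forall d, coefficient s d = (learning_coef P L d)%:C) ->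
  map_mx (real_complex R) (transition_mx P L n) = toeplitz (coefficient s) n.
Proof.
by move=> sc; apply/matrixP => i j; rewrite mxE [RHS]mxE sc transition_mxE.
Qed.

(** * The spectral radius and the H-infinity norm *)

Lemma modulusE (x : R[i]) : (modulus x)%:C = `|x|.
Proof. by rewrite /modulus RRe_real // normr_real. Qed.

Lemma modulus_ge0 (x : R[i]) : 0 <= modulus x.
Proof. by rewrite -ler0c modulusE. Qed.

Lemma filter_evalV Q z : filter_eval Q z^-1 = filter_eval Q z.
Proof.
rewrite /filter_eval; congr (_ + _); apply: eq_bigr => i _.
by rewrite exprVn invrK addrC.
Qed.

Lemma learning_symbolV P L z : learning_symbol P L z^-1 = learning_symbol P L z.
Proof. by rewrite /learning_symbol invrK !filter_evalV [in LHS]mulrAC. Qed.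

Lemma norm_expNj (t : R) : `|expNj t| = 1.
Proof. by rewrite normc_def /= sqrrN cos2Dsin2 sqrtr1. Qed.

(** Angles in [0, pi] only reach half of the circle; inversion reaches the other
    half. *)
Lemma unit_circle_expNj (z : R[i]) : `|z| = 1 ->
  exists2 t, t \in `[0, (pi : R)] & z = expNj t \/ z = (expNj t)^-1.
Proof.
move=> z1; have := add_Re2_Im2 z; rewrite z1 expr1n => /complexI zn.
case: z z1 zn => x y /= z1 zn.
have x1 : -1 <= x <= 1.
  by rewrite -ler_norml -(@expr_le1 _ 2) // real_normK ?num_real // -zn lerDl sqr_ge0.
exists (acos x); first by rewrite in_itv /= acos_ge0 ?acos_lepi.
rewrite -(conj_unit_circle (norm_expNj _)) /expNj sin_acos // acosK ?in_itv //.
rewrite -zn addrAC subrr add0r sqrtr_sqr /=.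
have [y0|y0] := leP 0 y; [right|left].
  by apply/eqP; rewrite eq_complex /= opprK (ger0_norm y0) !eqxx.
by apply/eqP; rewrite eq_complex /= (ltr0_norm y0) opprK !eqxx.
Qed.

Lemma learning_symbol_bounded P L : exists B : R,
  forall z, `|z| = 1 -> modulus (learning_symbol P L z) <= B.
Proof.
have [s [_ sF]] := learning_laurent P L.
exists (\sum_(t <- s) modulus t.1) => z z1; rewrite -lecR modulusE.
rewrite -sF ?unit_circle_neq0 // rmorph_sum /=.
apply: le_trans (ler_norm_sum _ _ _) _; apply: ler_sum => t _.
by rewrite normrM norm_exprz z1 exp1rz mulr1 -modulusE.
Qed.

Lemma modulus_le_Hinf P L z : `|z| = 1 ->
  modulus (learning_symbol P L z) <= Hinf_norm (learning_symbol P L).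
Proof.
have [B FB] := learning_symbol_bounded P L.
have sup_le t : t \in `[0, (pi : R)] ->
    modulus (learning_symbol P L (expNj t)) <= Hinf_norm (learning_symbol P L).
  move=> t0pi; apply: ub_le_sup; last by exists t.
  by exists B => _ [u _ <-]; apply/FB/norm_expNj.
move=> /unit_circle_expNj[t t0pi [->|->]]; first exact: sup_le.
by rewrite learning_symbolV sup_le.
Qed.

Lemma Hinf_le P L (B : R) :
    (forall z, `|z| = 1 -> modulus (learning_symbol P L z) <= B) ->
  Hinf_norm (learning_symbol P L) <= B.
Proof.
move=> FB; apply: ge_sup; last by move=> _ [t _ <-]; apply/FB/norm_expNj.
exists (modulus (learning_symbol P L (expNj 0))); exists 0 => //=.
by rewrite in_itv /= lexx pi_ge0.
Qed.

Lemma eigenvalue_le_spectral_radius n (A : 'M[R]_n) (l : R[i]) :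
  eigenvalue (map_mx (real_complex R) A) l -> `|l| <= (spectral_radius A)%:C.
Proof.
by rewrite -mem_eigenvalues -modulusE lecR => lA; exact: le_bigmax_seq.
Qed.

Lemma spectral_radius_le n (A : 'M[R]_n) (B : R) : 0 <= B ->
    (forall l, eigenvalue (map_mx (real_complex R) A) l -> modulus l <= B) ->
  spectral_radius A <= B.
Proof.
move=> B0 AB; rewrite /spectral_radius big_seq; apply: bigmax_le => // l.
by rewrite mem_eigenvalues; exact: AB.
Qed.

Lemma spectral_radius_le_Hinf P L n :
  spectral_radius (transition_mx P L n) <= Hinf_norm (learning_symbol P L).
Proof.
have [s [sc sF]] := learning_laurent P L.
apply: spectral_radius_le => [|l].
  exact: le_trans (modulus_ge0 _) (modulus_le_Hinf P L (norm_expNj 0)).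
rewrite (transition_mx_toeplitz n sc) => lA; rewrite -lecR modulusE.
apply: toeplitz_eigenvalue_le lA => z z1.
by rewrite sF ?unit_circle_neq0 // -modulusE lecR modulus_le_Hinf.
Qed.

Lemma Hinf_le_spectral_radius P L : exists K : R, forall n,
  Hinf_norm (learning_symbol P L)
  <= spectral_radius (transition_mx P L n.+1) + K * n.+1%:R^-1.
Proof.
have [s [sc sF]] := learning_laurent P L.
exists (\sum_(t <- s) modulus t.1 * `|t.2|%N%:R) => n.
apply: Hinf_le => z z1; rewrite -(ler_pM2l (ltr0Sn _ n)) mulrDr.
rewrite mulrCA mulfV ?pnatr_eq0 // mulr1 -lecR.
rewrite rmorphD !rmorphM rmorph_sum rmorph_nat /= modulusE.
rewrite -sF ?unit_circle_neq0 //.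
have := @symbol_le_eigenvalues _ s n.+1
  (spectral_radius (transition_mx P L n.+1))%:C z.
rewrite -(transition_mx_toeplitz n.+1 sc) => le_sF.
apply: le_trans (le_sF (transition_mx_hermitian P L _) _ z1) _.
  exact: eigenvalue_le_spectral_radius.
rewrite lerD2l; apply: ler_sum => t _.
by rewrite rmorphM rmorph_nat /= modulusE.
Qed.

(** Squeezed between |F|_oo - K / (n + 1) and |F|_oo. *)
Lemma spectral_radius_cvg P L :
  spectral_radius (transition_mx P L n) @[n --> \oo]
    --> Hinf_norm (learning_symbol P L).
Proof.
have [K HK] := Hinf_le_spectral_radius P L.
rewrite -cvg_shiftS /=.
apply: (@squeeze_cvgr _ _ _ _ (fun n => Hinf_norm (learning_symbol P L) - K * harmonic n)
  (fun=> Hinf_norm (learning_symbol P L))).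
- by apply: nearW => n; rewrite spectral_radius_le_Hinf lerBlDr HK.
- rewrite -[X in _ --> X]subr0 -[X in _ - X](mulr0 K).
  by apply: cvgB; [exact: cvg_cst | apply: cvgM; [exact: cvg_cst | exact: cvg_harmonic]].
- exact: cvg_cst.
Qed.

End LearningSymbol.

Theorem mainTheorem2 (R : realType) (P : plant R) (L : learning_filters R) :
  (forall n : nat, (0 < n)%N ->
     H_condition P L -> iteration_convergence P L n)
  /\
  (exists rho : R,
     (spectral_radius (transition_mx P L n) @[n --> \oo] --> rho)
     /\ (rho < 1 <-> H_condition P L)).
Proof.
split; first by move=> n _; exact/le_lt_trans/spectral_radius_le_Hinf.
by exists (Hinf_norm (learning_symbol P L)); split; first exact: spectral_radius_cvg.
Qed.
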